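(* Let $(M,F)$ be an $n$-dimensional Finsler manifold such that $F$ is a generalized isotropic Berwald metric, i.e. there are functions $\mu=\mu(x,y)$ and $\lambda=\lambda(x,y)$ on $TM_0$, homogeneous in $y$ of degrees $0$ and $-1$ respectively, with $$B^i_{\ jkl}=\mu\, C_{jkl}\,\ell^i+\lambda\,(h^i_j h_{kl}+h^i_k h_{jl}+h^i_l h_{jk}).$$ Then $F$ is a generalized Douglas-Weyl metric, i.e. $h^i_{\alpha}\,D^\alpha_{\ jkl|m}\,y^m=0$.
   Context: $M$ is an $n$-dimensional $C^\infty$ manifold and $TM_0=TM\setminus\{0\}$ is the slit tangent bundle, with standard local coordinates $(x^i,y^i)$. A Finsler metric is a function $F:TM\to[0,\infty)$ that is $C^\infty$ on $TM_0$, positively $1$-homogeneous on the fibers, and such that $g_{ij}=\frac12\frac{\partial^2 F^2}{\partial y^i\partial y^j}$ is positive definite at every $y\in T_xM\setminus\{0\}$. Indices are lowered and raised with $g_{ij}$ and its inverse $g^{ij}$. Homogeneity is positive homogeneity in $y$. Notation: $y_i=g_{ij}y^j$; $\ell^i=y^i/F$; $h_{ij}=g_{ij}-F^{-2}y_iy_j$ (angular metric), $h^i_j=\delta^i_j-F^{-2}y^iy_j$; Cartan torsion $C_{ijk}=\frac12\frac{\partial g_{ij}}{\partial y^k}$; spray coefficients $G^i=\frac14 g^{il}\{\frac{\partial^2F^2}{\partial x^k\partial y^l}y^k-\frac{\partial F^2}{\partial x^l}\}$; Berwald curvature $B^i_{\ jkl}=\frac{\partial^3G^i}{\partial y^j\partial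 y^k\partial y^l}$; mean Berwald curvature $E_{jk}=\frac12B^m_{\ jkm}$; Douglas curvature $$D^i_{\ jkl}=B^i_{\ jkl}-\frac{2}{n+1}\{E_{jk}\delta^i_l+E_{jl}\delta^i_k+E_{kl}\delta^i_j+E_{jk,l}\,y^i\},$$ where '', $l$'' denotes $\partial/\partial y^l$. Equivalently $D^i_{\ jkl}=\frac{\partial^3}{\partial y^j\partial y^k\partial y^l}\big(G^i-\frac1{n+1}\frac{\partial G^m}{\partial y^m}y^i\big)$. The symbol ''$|$'' denotes horizontal covariant derivative with respect to the Berwald connection: with $\delta_k=\frac{\partial}{\partial x^k}-\frac{\partial G^m}{\partial y^k}\frac{\partial}{\partial y^m}$ and $G^m_{ik}=\frac{\partial^2G^m}{\partial y^i\partial y^k}$, one has $T^i_{\ j|k}=\delta_kT^i_{\ j}+T^m_{\ j}G^i_{mk}-T^i_{\ m}G^m_{jk}$, and analogously for other tensors. *)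

(* Defs.v *)
From HB Require Import structures.
From mathcomp Require Import all_boot all_order all_algebra.
From mathcomp Require Import all_classical all_reals all_analysis.

Set Implicit Arguments.
Unset Strict Implicit.
Unset Printing Implicit Defensive.

Import Order.TTheory GRing.Theory Num.Theory.
Import numFieldNormedType.Exports.

Local Open Scope classical_set_scope.
Local Open Scope ring_scope.

(* Meant for open [A] in finite dimension, where this is the usual class C^k:
   continuous partial derivatives up to order [k]. *)
Fixpoint Ck (R : realType) (V W : normedModType R) (k : nat) (A : set V)
    (f : V -> W) : Prop :=
  if k is k'.+1 then
    (forall x, A x -> differentiable f x) /\
    (forall v, Ck k' A (fun x => 'D_v f x))
  else forall x, A x -> {for x, continuous f}.

Definition Cinfty (R : realType) (V W : normedModType R) (A : set V)
  (f : V -> W) := forall k, Ck k A f.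

Lemma derive_chain (R : realType) (V W X : normedModType R) (f : V -> W)
    (g : W -> X) (h : V -> X) (x y : V) :
  differentiable f x -> differentiable g (f x) ->
  (\forall z \near x, h z = g (f z)) ->
  'D_('D_y f x) g (f x) = 'D_y h x.
Proof.
move=> df dg hE; rewrite (near_eq_derive (g := g \o f) _ hE).
have dgf := differentiable_comp df dg.
by rewrite (deriveE _ dg) (deriveE _ df) (deriveE _ dgf) (diff_comp df dg).
Qed.

(* [cinv] is only meaningful on the range [cmap @` cdom]. *)
Record chart (R : realType) (n : nat) (M : topologicalType) := Chart {
  cdom : set M;
  cmap : M -> 'rV[R]_n;
  cinv : 'rV[R]_n -> M;
  open_cdom : open cdom;
  open_crange : open (cmap @` cdom);
  cmapK : forall p, cdom p -> cinv (cmap p) = p;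
  cmap_continuous : forall p, cdom p -> {for p, continuous cmap};
  cinv_continuous : forall x, (cmap @` cdom) x -> {for x, continuous cinv} }.

Definition crange (R : realType) (n : nat) (M : topologicalType)
  (c : chart R n M) : set 'rV[R]_n := cmap c @` cdom c.

Definition transition (R : realType) (n : nat) (M : topologicalType)
  (c d : chart R n M) : 'rV[R]_n -> 'rV[R]_n := cmap d \o cinv c.

Record manifold (R : realType) (n : nat) := Manifold {
  mspace :> topologicalType;
  mhausdorff : hausdorff_space mspace;
  msecond_countable : @second_countable mspace;
  mindex : Type;
  mchart : mindex -> chart R n mspace;
  mcover : forall p, exists i, cdom (mchart i) p;
  mtransition : forall i j,
    Cinfty (cmap (mchart i) @` (cdom (mchart i) `&` cdom (mchart j)))
           (transition (mchart i) (mchart j)) }.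

Arguments mchart {R n} m _.

Section TangentBundle.
Context {R : realType} {n : nat} (M : manifold R n).
Local Notation I := (mindex M).
Local Notation U i := (cdom (mchart M i)).
Local Notation phi i := (cmap (mchart M i)).
Local Notation tau i j := (transition (mchart M i) (mchart M j)).

(* A tangent vector is given by its components in all the charts around its
   base point, subject to the contravariant transformation law; [tcomp_out]
   normalizes the components in the other charts. *)
Record tangent_bundle := TangentVector {
  tbase : M;
  tcomp : I -> 'rV[R]_n;
  tcomp_transition : forall i j, U i tbase -> U j tbase ->
    tcomp j = 'D_(tcomp i) (tau i j) (phi i tbase);
  tcomp_out : forall i, ~ U i tbase -> tcomp i = 0 }.

Definition slit (v : tangent_bundle) := exists i, tcomp v i != 0.

Lemma transition_differentiable i j p : U i p -> U j p ->
  differentiable (tau i j) (phi i p).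
Proof.
move=> ip jp; have [+ _] := mtransition i j 1.
by apply; exists p.
Qed.

Lemma transition_comp i j k p (y : 'rV[R]_n) : U i p -> U j p -> U k p ->
  'D_('D_y (tau i j) (phi i p)) (tau j k) (phi j p) = 'D_y (tau i k) (phi i p).
Proof.
move=> ip jp kp.
have pE : phi j p = tau i j (phi i p) by rewrite /transition /= cmapK.
have dij := transition_differentiable ip jp.
have := transition_differentiable jp kp.
rewrite pE => djk; apply: derive_chain => //.
have ri : (phi i @` U i) (phi i p) by exists p.
have Uj : \forall x \near phi i p, U j (cinv (mchart M i) x).
  apply: (cinv_continuous ri); rewrite cmapK //.
  exact: open_nbhs_nbhs (conj (open_cdom _) jp).
by apply: filterS Uj => x jx; rewrite /transition /= cmapK.
Qed.

Definition tscale_comp (a : R) (v : tangent_bundle) i := a *: tcomp v i.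

Lemma tscale_transition a v i j : U i (tbase v) -> U j (tbase v) ->
  tscale_comp a v j = 'D_(tscale_comp a v i) (tau i j) (phi i (tbase v)).
Proof.
move=> iv jv; have d := transition_differentiable iv jv.
by rewrite /tscale_comp (tcomp_transition iv jv) !deriveE // linearZ.
Qed.

Lemma tscale_out a v i : ~ U i (tbase v) -> tscale_comp a v i = 0.
Proof. by move=> /tcomp_out; rewrite /tscale_comp => ->; rewrite scaler0. Qed.

Definition tscale a v : tangent_bundle :=
  TangentVector (@tscale_transition a v) (@tscale_out a v).

Section LocalCoordinates.
Variables (i : I) (x y : 'rV[R]_n).
Local Notation p := (cinv (mchart M i) x).

Definition tlocal_comp j : 'rV[R]_n :=
  if `[< U i p /\ U j p >] then 'D_y (tau i j) (phi i p) else 0.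

Lemma tlocal_transition j k : U j p -> U k p ->
  tlocal_comp k = 'D_(tlocal_comp j) (tau j k) (phi j p).
Proof.
move=> jp kp; rewrite /tlocal_comp.
case: asboolP => [[ip _]|nik]; case: asboolP => [[i'p _]|nij].
- by rewrite transition_comp.
- by case: nij.
- by case: nik.
- by rewrite deriveE ?linear0 //; exact: transition_differentiable.
Qed.

Lemma tlocal_out j : ~ U j p -> tlocal_comp j = 0.
Proof. by move=> njp; rewrite /tlocal_comp; case: asboolP => // -[]. Qed.

(* The tangent vector y^k d/dx^k at the point with coordinates x in chart i. *)
Definition tlocal : tangent_bundle :=
  TangentVector tlocal_transition tlocal_out.

End LocalCoordinates.

Lemma tlocal_compE i x y : crange (mchart M i) x -> tcomp (tlocal i x y) i = y.
Proof.
move=> [p ip <-]; rewrite /= /tlocal_comp cmapK //.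
case: asboolP => [_|[]//].
rewrite (near_eq_derive (g := id)); first by rewrite derive_id.
have nr : nbhs (phi i p) (phi i @` U i).
  by apply: open_nbhs_nbhs; split; [exact: open_crange|exists p].
by apply: filterS nr => z [q iq <-]; rewrite /transition /= cmapK.
Qed.

End TangentBundle.

Section LocalFormulas.
Context {R : realType} {n : nat}.
Local Notation V := 'rV[R]_n.

Definition dx (k : 'I_n) (f : V -> V -> R) : V -> V -> R :=
  fun x y => 'D_(delta_mx 0 k : V) (fun x' => f x' y) x.

Definition dy (k : 'I_n) (f : V -> V -> R) : V -> V -> R :=
  fun x y => 'D_(delta_mx 0 k : V) (fun y' => f x y') y.

Variable F : V -> V -> R.
Implicit Types (x y : V) (i j k l m : 'I_n).

Definition Fsq x y := F x y ^+ 2.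

Definition gmx x y : 'M[R]_n := \matrix_(i, j) (2^-1 * dy i (dy j Fsq) x y).
Definition g i j x y := gmx x y i j.
Definition ginv i j x y := invmx (gmx x y) i j.

Definition ylow j x y := \sum_k g j k x y * y 0 k.
Definition ell i x y := y 0 i / F x y.
Definition hlow i j x y := g i j x y - F x y ^- 2 * ylow i x y * ylow j x y.
Definition hmix i j x y := (i == j)%:R - F x y ^- 2 * y 0 i * ylow j x y.

Definition cartan i j k x y := 2^-1 * dy k (g i j) x y.

Definition spray i x y := 4^-1 * \sum_l ginv i l x y *
  ((\sum_k dx k (dy l Fsq) x y * y 0 k) - dx l Fsq x y).

Definition berwald i j k l := dy j (dy k (dy l (spray i))).

Definition mean_berwald j k x y := 2^-1 * \sum_m berwald m j k m x y.

Definition douglas i j k l x y :=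
  berwald i j k l x y - 2 / n.+1%:R *
   (mean_berwald j k x y * (i == l)%:R + mean_berwald j l x y * (i == k)%:R
    + mean_berwald k l x y * (i == j)%:R + dy l (mean_berwald j k) x y * y 0 i).

Definition nconn m k := dy k (spray m).
Definition bconn m i k := dy i (dy k (spray m)).

Definition delta k (f : V -> V -> R) x y :=
  dx k f x y - \sum_m nconn m k x y * dy m f x y.

(* T^i_{jkl|m} *)
Definition hcov (T : 'I_n -> 'I_n -> 'I_n -> 'I_n -> V -> V -> R) i j k l m
    x y :=
  delta m (T i j k l) x y
  + \sum_a T a j k l x y * bconn i a m x y
  - \sum_a T i a k l x y * bconn a j m x y
  - \sum_a T i j a l x y * bconn a k m x y
  - \sum_a T i j k a x y * bconn a l m x y.

End LocalFormulas.

Section FinslerMetrics.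
Context {R : realType} {n : nat} {M : manifold R n}.
Implicit Types (F f : tangent_bundle M -> R).

Definition in_chart f (c : mindex M) : 'rV[R]_n -> 'rV[R]_n -> R :=
  fun x y => f (tlocal c x y).

Record is_finsler F : Prop := IsFinsler {
  finsler_ge0 : forall v, 0 <= F v;
  finsler_smooth : forall c,
    Cinfty [set z : 'rV[R]_n * 'rV[R]_n | crange (mchart M c) z.1 /\ z.2 != 0]
           (fun z => in_chart F c z.1 z.2);
  finsler_homogeneous : forall a v, 0 < a -> F (tscale a v) = a * F v;
  finsler_posdef : forall c x y, crange (mchart M c) x -> y != 0 ->
    forall u : 'rV[R]_n, u != 0 ->
      0 < \sum_i \sum_j g (in_chart F c) i j x y * u 0 i * u 0 j }.

(* A function on the slit bundle is a function on the bundle whose values at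
   zero vectors are ignored. *)
Definition slit_homogeneous (d : int) f :=
  forall a v, slit v -> 0 < a -> f (tscale a v) = a ^ d * f v.

Definition generalized_isotropic_berwald F :=
  exists mu lambda : tangent_bundle M -> R,
  [/\ slit_homogeneous 0 mu, slit_homogeneous (-1) lambda &
   forall c x y, crange (mchart M c) x -> y != 0 ->
   let L := in_chart F c in
   forall i j k l : 'I_n,
     berwald L i j k l x y =
       mu (tlocal c x y) * cartan L j k l x y * ell L i x y
       + lambda (tlocal c x y) *
         (hmix L i j x y * hlow L k l x y + hmix L i k x y * hlow L j l x y
          + hmix L i l x y * hlow L j k x y)].

Definition generalized_douglas_weyl F :=
  forall c x y, crange (mchart M c) x -> y != 0 ->
  let L := in_chart F c in
  forall i j k l : 'I_n,
    \sum_a hmix L i a x y *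
      (\sum_m hcov L (douglas L) a j k l m x y * y 0 m) = 0.

End FinslerMetrics.

(* Main.v *)
From HB Require Import structures.
Require Import Defs.
From mathcomp Require Import all_boot all_order all_algebra.
From mathcomp Require Import all_classical all_reals all_analysis.
From mathcomp Require Import ring lra.

Set Implicit Arguments.
Unset Strict Implicit.
Unset Printing Implicit Defensive.

Import Order.TTheory GRing.Theory Num.Theory.
Import numFieldNormedType.Exports.

Local Open Scope classical_set_scope.
Local Open Scope ring_scope.

(** The idea is that the Douglas tensor of a generalized isotropic Berwald
    metric is radial, D^i_jkl = d_jkl y^i, and that covariant differentiation
    keeps radial tensors radial, while h^i_a kills the direction y.

    Why D is radial ([douglas_isotropic]).  Tracing the hypothesis, the Cartan
    term disappears because C_jkm y^m = 0, and h^m_j h_km = h_kj together with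
    h^m_m = n - 1 give E_jk = (n + 1)/2 lambda h_jk
    ([mean_berwald_isotropic]).  In D the three terms E_jk delta^i_l then
    cancel the delta parts of lambda (h^i_j h_kl + ...), and every term that
    is left has the factor y^i, including the derivative of E, whatever its
    value is.

    Why radiality survives the derivative ([hcov_radial]).  If T^i = d y^i,
    the terms of T^i_|m in which y^i is not a factor are
    d (- N^i_m + y^b G^i_bm), where N^i_m = dG^i/dy^m is homogeneous of degree
    1 in y and G^i_bm = dN^i_m/dy^b; they cancel by Euler's theorem.  To
    differentiate d one must know that it is smooth, although mu and lambda
    are arbitrary functions: d is recovered as the smooth function
    y_i D^i_jkl / F^2.

    The analytic input is that functions built from a smooth F by partial
    derivatives, arithmetic and matrix inversion are smooth, that second
    partial derivatives commute ([Schwarz], for the symmetry of g_ij), and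
    Euler's theorem ([Euler]).  Positive definiteness of g makes the metric
    invertible and, as g_ij y^i y^j = F^2, keeps F away from 0. *)

(** * Symmetry of second derivatives *)

Section SecondDerivatives.
Context {R : realType} {V : normedModType R}.
Implicit Types (f : V -> R) (u v w x : V).

Lemma is_derive_line f w u (s : R) : differentiable f (w + s *: u) ->
  is_derive s 1 (fun t => f (w + t *: u)) ('D_u f (w + s *: u)).
Proof.
move=> df; pose l (t : R) : V := w + t *: u.
have dl : is_diff s l (fun t : R => t *: u).
  by apply: is_diff_eq; rewrite add0r.
have dh : differentiable (f \o l) s.
  by apply: differentiable_comp => //; exact: (@ex_diff _ _ _ _ _ _ _ dl).
apply: DeriveDef; first exact: diff_derivable.
rewrite -(derive_chain (f := l) (g := f)) //; last by apply: filterE.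
have := @deriveE _ _ _ l s 1 (@ex_diff _ _ _ _ _ _ _ dl).
by rewrite (@diff_val _ _ _ _ _ _ _ dl) scale1r => ->.
Qed.

Lemma differentiable_expand f x (eps : R) : differentiable f x -> 0 < eps ->
  \forall w \near (0 : V),
    `|f (w + x) - (f x + 'd f x w)| <= eps * `|w|.
Proof.
move=> /diff_locally/eqaddoP df e0.
exact: df.
Qed.

(** The mean value theorem along [u], applied to
    [t |-> f (x + h v + t u) - f (x + t u)], reduces the second difference to
    an increment of ['D_u f], which differentiability of ['D_u f] at the single
    point [x] approximates by [h * 'D_v ('D_u f) x] up to [o(h)]. *)
Lemma second_difference f u v x (e : R) :
  (\forall z \near x, differentiable f z) ->
  differentiable ('D_u f) x -> 0 < e ->
  \forall h \near 0^'+,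
    `|(f (x + h *: u + h *: v) - f (x + h *: u) - f (x + h *: v) + f x)
       - h ^+ 2 * 'D_v ('D_u f) x| <= e * h ^+ 2.
Proof.
move=> nf du e0.
(* [h * c] bounds the displacements [s u + t v] with s, t in [0, h]. *)
set c := `|u| + `|v| + 1.
have c0 : 0 < c by rewrite ltr_wpDl// addr_ge0.
(* Two increments are compared, each with an error [eps * (h * c)]. *)
set eps := e / (2 * c).
have eps0 : 0 < eps by rewrite divr_gt0// mulr_gt0.
have nf0 : \forall w \near (0 : V), differentiable f (w + x).
  by move/nbhs0P: nf; apply: filterS => w; rewrite addrC.
have near1 : \forall w \near (0 : V), differentiable f (w + x) /\
    `|'D_u f (w + x) - ('D_u f x + 'd ('D_u f) x w)| <= eps * `|w|.
  by apply: filterI => //; exact: differentiable_expand.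
move/nbhs_ballP: near1 => [r /= r0 nr].
have small (s t h : R) : 0 <= s <= h -> 0 <= t <= h ->
    `|s *: u + t *: v| <= h * c.
  move=> /andP[s0 sh] /andP[t0 th]; rewrite (le_trans (ler_normD _ _))//.
  rewrite !normrZ !ger0_norm// /c !mulrDr -addrA lerD// ?ler_wpM2r//.
  by rewrite ler_wpDr ?ler_wpM2r// mulr1 (le_trans s0).
near=> h.
have h0 : 0 < h by near: h; exact: nbhs_right_gt.
have hr : h * c < r.
  by rewrite -ltr_pdivlMr//; near: h; apply: nbhs_right_lt; rewrite divr_gt0.
have inr (s t : R) : 0 <= s <= h -> 0 <= t <= h ->
    differentiable f (s *: u + t *: v + x) /\
    `|'D_u f (s *: u + t *: v + x) -
       ('D_u f x + 'd ('D_u f) x (s *: u + t *: v))| <= eps * (h * c).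
  move=> sh th; have suv := small _ _ _ sh th.
  have [|d1 d2] := nr (s *: u + t *: v).
    by rewrite -ball_normE /= sub0r normrN (le_lt_trans suv).
  by split=> //; rewrite (le_trans d2)// ler_pM2l.
have hh : 0 <= h <= h by rewrite lexx ltW.
have h00 : 0 <= (0 : R) <= h by rewrite lexx ltW.
pose psi (t : R) := f (x + h *: v + t *: u) - f (x + t *: u).
pose dpsi (t : R) := 'D_u f (x + h *: v + t *: u) - 'D_u f (x + t *: u).
have dpsiP t : 0 <= t <= h -> is_derive t 1 psi (dpsi t).
  move=> th; apply: is_deriveB; apply: is_derive_line.
    by have [] := inr _ _ th hh; rewrite addrC [t *: u + _]addrC addrA.
  by have [] := inr _ _ th h00; rewrite scale0r addr0 addrC.
have [t /andP[t0 th]||t] := @MVT _ psi dpsi 0 h h0.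
- by apply: dpsiP; rewrite !ltW.
- apply: derivable_within_continuous => t; rewrite in_itv /= => th.
  by have [] := dpsiP _ th.
rewrite in_itv /= => /andP[t0 th].
rewrite /psi /dpsi !scale0r !addr0 subr0 => E.
have th' : 0 <= t <= h by rewrite !ltW.
have [_] := inr _ _ th' hh; have [_] := inr _ _ th' h00.
rewrite scale0r addr0.
have -> : 'd ('D_u f) x (t *: u + h *: v) =
    'd ('D_u f) x (t *: u) + 'd ('D_u f) x (h *: v) by rewrite linearD.
have -> : 'd ('D_u f) x (h *: v) = h * 'D_v ('D_u f) x.
  by rewrite linearZ deriveE.
have -> : x + h *: u + h *: v = x + h *: v + h *: u by rewrite addrAC.
have -> : t *: u + x = x + t *: u by rewrite addrC.
have -> : t *: u + h *: v + x = x + h *: v + t *: u.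
  by rewrite addrC [t *: u + _]addrC addrA.

move: E; set A1 := 'D_u f (x + h *: v + t *: u); set A0 := 'D_u f (x + t *: u).
set dt := 'd _ x _; set B := 'D_v _ x; set d := 'D_u f x.
set f11 := f _; set f10 := f (x + _); set f01 := f (x + _); set f00 := f x.
move=> E /ler_normlP[e1 e2] /ler_normlP[e3 e4].
have -> : f11 - f10 - f01 + f00 - h ^+ 2 * B = h * (A1 - A0 - h * B).
  rewrite expr2 mulrBr mulrA; congr (_ - _); rewrite [RHS]mulrC -E; ring.
have epsc : 2 * (eps * (h * c)) = h * e.
  by rewrite /eps; field; rewrite gt_eqF.
rewrite normrM gtr0_norm// (_ : e * h ^+ 2 = h * (h * e)); last by ring.
rewrite ler_pM2l// -epsc.
rewrite ler_norml; apply/andP; split; lra.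
Unshelve. all: by end_near. Qed.

(** Both iterated derivatives approximate the same second difference, which is
    symmetric in [u] and [v]. *)
Lemma Schwarz f u v x :
  (\forall z \near x, differentiable f z) ->
  differentiable ('D_u f) x -> differentiable ('D_v f) x ->
  'D_v ('D_u f) x = 'D_u ('D_v f) x.
Proof.
move=> nf du dv; apply/eqP; rewrite -subr_eq0 -normr_le0.
apply/ler_addgt0Pr => e e0; rewrite add0r.
have e2 : 0 < e / 2 by rewrite divr_gt0.
have [h [[h1 h2] h0]] := filter_ex (filterI (filterI
  (second_difference v nf du e2) (second_difference u nf dv e2))
  (nbhs_right_gt (0 : R))).
have hh : 0 < h ^+ 2 by rewrite exprn_gt0.
rewrite -(ler_pM2l hh) -{1}(gtr0_norm hh) -normrM.
have -> : h ^+ 2 * e = e / 2 * h ^+ 2 + e / 2 * h ^+ 2.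
  by rewrite -mulrDl -splitr mulrC.
rewrite mulrBr; apply: le_trans (ler_distD _ _ _) (lerD _ h2).
rewrite distrC; apply: le_trans h1.
by rewrite [x + h *: u + h *: v]addrAC [f _ - _ - _]addrAC.
Qed.
End SecondDerivatives.
(** * Smooth functions on an open set *)

Section SmoothFunctions.
Context {R : realType} {V : normedModType R} (A : set V).
Hypothesis openA : open A.
Implicit Types (f g : V -> R) (x v : V).

Lemma near_eq_differentiable f g x :
  (\forall z \near x, f z = g z) -> differentiable f x -> differentiable g x.
Proof.
move=> fg df.
have gE : g \o shift x = cst (g x) + 'd f x +o_ 0 id.
  apply/eqaddoP => e e0; have /diff_locally/eqaddoP/(_ e e0) := df.
  have /nbhs0P := fg; apply: filterS2 => w; rewrite addrC => fgw.
  by rewrite !fctE /= /shift /= fgw (nbhs_singleton fg).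
have cdf := diff_continuous df.
by apply/diff_locallyP; rewrite (diff_unique cdf gE); split.
Qed.

Lemma near_open x : A x -> \forall z \near x, A z.
Proof. by move=> Ax; exact: open_nbhs_nbhs. Qed.

Lemma Ck_ext k f g : (forall x, A x -> f x = g x) -> Ck k A f -> Ck k A g.
Proof.
elim: k f g => [|k IH] f g fg /=.
  move=> cf x Ax; have gf : \forall z \near x, f z = g z.
    by apply: filterS (near_open Ax).
  have : g @ x --> f x.
    by apply: cvg_trans (cf x Ax); apply: near_eq_cvg.
  by rewrite (fg x Ax).
move=> [df Df]; split=> [x Ax|v].
  apply: near_eq_differentiable (df x Ax).
  by apply: filterS (near_open Ax).
apply: IH (Df v) => x Ax; apply: near_eq_derive.
by apply: filterS (near_open Ax).
Qed.

Lemma CkS k f : Ck k.+1 A f -> Ck k A f.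
Proof.
elim: k f => [|k IH] f /= [df Df].
  by move=> x Ax; apply: differentiable_continuous; exact: df.
by split=> // v; apply: IH; exact: Df.
Qed.

Lemma Ck_cst k (a : R) : Ck k A (fun=> a : R).
Proof.
elim: k a => [|k IH] a /=; first by move=> x _; exact: cst_continuous.
split=> [x _|v]; first exact: differentiable_cst.
by apply: Ck_ext (IH 0) => x _; rewrite derive_cst.
Qed.

Lemma Ck_add k f g : Ck k A f -> Ck k A g -> Ck k A (fun x => f x + g x).
Proof.
elim: k f g => [|k IH] f g /=.
  by move=> cf cg x Ax; apply: continuousD; [exact: cf|exact: cg].
move=> [df Df] [dg Dg]; split=> [x Ax|v].
  by apply: differentiableD; [exact: df|exact: dg].
apply: Ck_ext (IH _ _ (Df v) (Dg v)) => x Ax.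
by rewrite [RHS]deriveD//; apply: diff_derivable; [exact: df|exact: dg].
Qed.

Lemma Ck_mul k f g : Ck k A f -> Ck k A g -> Ck k A (fun x => f x * g x).
Proof.
elim: k f g => [|k IH] f g.
  by move=> cf cg x Ax; apply: continuousM; [exact: cf|exact: cg].
move=> Cf Cg; have [[df Df] [dg Dg]] := (Cf, Cg); split=> [x Ax|v].
  by apply: differentiableM; [exact: df|exact: dg].
have := Ck_add (IH _ _ (CkS Cf) (Dg v)) (IH _ _ (CkS Cg) (Df v)).
apply: Ck_ext => x Ax.
by rewrite [RHS]deriveM//; apply: diff_derivable; [exact: df|exact: dg].
Qed.

Lemma Ck_inv k f : (forall x, A x -> f x != 0) -> Ck k A f ->
  Ck k A (fun x => (f x)^-1).
Proof.
move=> f0; elim: k => [|k IH].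
  by move=> cf x Ax; apply: cvgV; [exact: f0|exact: cf].
move=> Cf; have [df Df] := Cf; split=> [x Ax|v].
  by apply: differentiableV; [exact: df|exact: f0].
have IHf := IH (CkS Cf).
have := Ck_mul (Ck_cst k (-1)) (Ck_mul (Ck_mul IHf IHf) (Df v)).
apply: Ck_ext => x Ax.
rewrite [RHS]deriveV ?f0//; last by apply: diff_derivable; exact: df.
by rewrite mulN1r scaleNr -invfM.
Qed.

Lemma Cinfty_ext f g : (forall x, A x -> f x = g x) ->
  Cinfty A f -> Cinfty A g.
Proof. by move=> fg Cf k; exact: Ck_ext (Cf k). Qed.

Lemma Cinfty_cst (a : R) : Cinfty A (fun=> a : R).
Proof. by move=> k; exact: Ck_cst. Qed.

Lemma Cinfty_add f g : Cinfty A f -> Cinfty A g ->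
  Cinfty A (fun x => f x + g x).
Proof. by move=> Cf Cg k; exact: Ck_add. Qed.

Lemma Cinfty_mul f g : Cinfty A f -> Cinfty A g ->
  Cinfty A (fun x => f x * g x).
Proof. by move=> Cf Cg k; exact: Ck_mul. Qed.

Lemma Cinfty_inv f : (forall x, A x -> f x != 0) -> Cinfty A f ->
  Cinfty A (fun x => (f x)^-1).
Proof. by move=> f0 Cf k; exact: Ck_inv. Qed.

Lemma Cinfty_opp f : Cinfty A f -> Cinfty A (fun x => - f x).
Proof.
move=> /(Cinfty_mul (Cinfty_cst (-1))).
by apply: Cinfty_ext => x _; rewrite mulN1r.
Qed.

Lemma Cinfty_sub f g : Cinfty A f -> Cinfty A g ->
  Cinfty A (fun x => f x - g x).
Proof. by move=> Cf Cg; apply: Cinfty_add => //; exact: Cinfty_opp. Qed.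

Lemma Cinfty_sum (I : Type) (r : seq I) (P : pred I) (F : I -> V -> R) :
  (forall i, P i -> Cinfty A (F i)) ->
  Cinfty A (fun x => \sum_(i <- r | P i) F i x).
Proof.
move=> CF; elim: r => [|i r IH].
  by apply: Cinfty_ext (Cinfty_cst 0) => x _; rewrite big_nil.
have [Pi|nPi] := boolP (P i).
  by apply: Cinfty_ext (Cinfty_add (CF _ Pi) IH) => x _; rewrite big_cons Pi.
by apply: Cinfty_ext IH => x _; rewrite big_cons (negbTE nPi).
Qed.

Lemma Cinfty_prod (I : Type) (r : seq I) (P : pred I) (F : I -> V -> R) :
  (forall i, P i -> Cinfty A (F i)) ->
  Cinfty A (fun x => \prod_(i <- r | P i) F i x).
Proof.
move=> CF; elim: r => [|i r IH].
  by apply: Cinfty_ext (Cinfty_cst 1) => x _; rewrite big_nil.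
have [Pi|nPi] := boolP (P i).
  by apply: Cinfty_ext (Cinfty_mul (CF _ Pi) IH) => x _; rewrite big_cons Pi.
by apply: Cinfty_ext IH => x _; rewrite big_cons (negbTE nPi).
Qed.

(** The Leibniz formula is a polynomial in the entries; with Cramer's rule it
    gives the smoothness of the inverse matrix below. *)
Lemma Cinfty_det n (M : V -> 'M[R]_n) :
  (forall i j, Cinfty A (fun x => M x i j)) -> Cinfty A (fun x => \det (M x)).
Proof.
move=> CM; apply: Cinfty_sum => s _.
by apply: Cinfty_mul; [exact: Cinfty_cst|apply: Cinfty_prod => i _].
Qed.

Lemma Cinfty_invmx n (M : V -> 'M[R]_n) :
  (forall x, A x -> M x \in unitmx) ->
  (forall i j, Cinfty A (fun x => M x i j)) ->
  forall i j, Cinfty A (fun x => invmx (M x) i j).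
Proof.
move=> Mu CM i j.
have Cadj : Cinfty A (fun x => \adj (M x) i j).
  suff : Cinfty A (fun x => cofactor (M x) j i).
    by apply: Cinfty_ext => x _; rewrite mxE.
  apply: Cinfty_mul; first exact: Cinfty_cst.
  apply: Cinfty_det => a b.
  by apply: Cinfty_ext (CM (lift j a) (lift i b)) => x _; rewrite !mxE.
have det0 x : A x -> \det (M x) != 0.
  by move=> Ax; rewrite -unitfE -unitmxE; exact: Mu.
apply: Cinfty_ext (Cinfty_mul (Cinfty_inv det0 (Cinfty_det CM)) Cadj) => x Ax.
by rewrite /invmx Mu// [RHS]mxE.
Qed.

Lemma Cinfty_differentiable f x : Cinfty A f -> A x -> differentiable f x.
Proof. by move=> /(_ 1%N)[df _]; exact: df. Qed.

Lemma Cinfty_derive f v : Cinfty A f -> Cinfty A ('D_v f).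
Proof. by move=> Cf k; have [_] := Cf k.+1; exact. Qed.

Lemma Cinfty_linear (f : {linear V -> R}) : continuous f -> Cinfty A f.
Proof.
move=> cf [|k]; first by move=> x _; exact: cf.
split=> [x _|v]; first exact: linear_differentiable.
apply: Ck_ext (Ck_cst k (f v)) => x _.
by rewrite deriveE ?diff_lin//; exact: linear_differentiable.
Qed.

Lemma derive_swap f u v x : Cinfty A f -> A x ->
  'D_v ('D_u f) x = 'D_u ('D_v f) x.
Proof.
move=> Cf Ax; apply: (Schwarz (x := x)).
- by apply: filterS (near_open Ax) => z; exact: Cinfty_differentiable.
- exact: Cinfty_differentiable (Cinfty_derive _ Cf) Ax.
- exact: Cinfty_differentiable (Cinfty_derive _ Cf) Ax.
Qed.

End SmoothFunctions.
(** * Smooth homogeneous functions on the slit tangent space *)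

Section SlitFunctions.
Context {R : realType} {n : nat}.
Local Notation V := 'rV[R]_n.
Variable U : set V.
Hypothesis openU : open U.
Implicit Types (f : V -> V -> R) (x y : V) (i j k l m : 'I_n).

Definition slit_domain : set (V * V) := [set z | U z.1 /\ z.2 != 0].

Definition smooth f := Cinfty slit_domain (fun z => f z.1 z.2).

Definition fiber_hom (d : nat) f :=
  forall (t : R) x y, 0 < t -> U x -> y != 0 -> f x (t *: y) = t ^+ d * f x y.

Lemma open_nonzero : open [set y : V | y != 0].
Proof.
rewrite (_ : mkset _ = ~` [set 0]); last first.
  by apply/seteqP; split=> y /= /eqP.
apply/closed_openC/accessible_closed_set1/hausdorff_accessible.
exact: norm_hausdorff.
Qed.

Lemma open_slit_domain : open slit_domain.
Proof.
rewrite (_ : slit_domain = (fst @^-1` U) `&` (snd @^-1` [set y | y != 0])) //.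
apply: openI.
  by apply: open_comp => // z _; exact: cvg_fst.
by apply: open_comp; [move=> z _; exact: cvg_snd|exact: open_nonzero].
Qed.

(** Partial derivatives are directional derivatives on the product space, so
    that joint smoothness passes to them.  The equality holds for every [f],
    differentiable or not, since the difference quotients are the same. *)
Lemma dxE k f : (fun z => dx k f z.1 z.2) =
  'D_((delta_mx 0 k, 0) : V * V) (fun z => f z.1 z.2).
Proof.
apply/funext => -[x y]; rewrite /dx /derive /=.
rewrite (_ : (fun h => _) = fun h : R =>
  h^-1 *: (f (h *: delta_mx 0 k + x) (h *: 0 + y) - f x y)) //.
by apply/funext => h /=; rewrite scaler0 add0r.
Qed.

Lemma dyE k f : (fun z => dy k f z.1 z.2) =
  'D_((0, delta_mx 0 k) : V * V) (fun z => f z.1 z.2).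
Proof.
apply/funext => -[x y]; rewrite /dy /derive /=.
rewrite (_ : (fun h => _) = fun h : R =>
  h^-1 *: (f (h *: 0 + x) (h *: delta_mx 0 k + y) - f x y)) //.
by apply/funext => h /=; rewrite scaler0 add0r.
Qed.

Lemma smooth_dx k f : smooth f -> smooth (dx k f).
Proof. by rewrite /smooth dxE; exact: Cinfty_derive. Qed.

Lemma smooth_dy k f : smooth f -> smooth (dy k f).
Proof. by rewrite /smooth dyE; exact: Cinfty_derive. Qed.

Lemma dy_swap i j f x y : smooth f -> U x -> y != 0 ->
  dy i (dy j f) x y = dy j (dy i f) x y.
Proof.
move=> sf Ux y0; have Uxy : slit_domain (x, y) by [].
have dydyE a b : dy a (dy b f) x y = 'D_((0, delta_mx 0 a) : V * V)
    ('D_((0, delta_mx 0 b) : V * V) (fun z => f z.1 z.2)) (x, y).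
  by have := congr1 (@^~ (x, y)) (dyE a (dy b f)); rewrite dyE => <-.
by rewrite !dydyE; exact: (derive_swap open_slit_domain).
Qed.

Lemma smooth_coord i : smooth (fun _ y => y 0 i).
Proof.
pose f (z : V * V) : R := z.2 0 i.
have lf : linear f by move=> a u v; rewrite /f /= !mxE.
pose fM := GRing.isLinear.Build _ _ _ _ f lf.
pose fL : {linear (V * V)%type -> R} := HB.pack f fM.
apply: (Cinfty_linear open_slit_domain (f := fL)) => z.
apply: (continuous_comp (f := snd) (g := fun y : V => y 0 i)).
  exact: cvg_snd.
exact: coord_continuous.
Qed.

Lemma smooth_differentiable_x f x y : smooth f -> U x -> y != 0 ->
  differentiable (fun x' => f x' y) x.
Proof.
move=> sf Ux y0.
apply: (differentiable_comp (f := fun x' => (x', y)) (g := fun z => f z.1 z.2)).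
  by apply: differentiable_pair.
exact: (Cinfty_differentiable (f := fun z => f z.1 z.2) sf).
Qed.

Lemma smooth_differentiable_y f x y : smooth f -> U x -> y != 0 ->
  differentiable (f x) y.
Proof.
move=> sf Ux y0.
apply: (differentiable_comp (f := fun y' => (x, y')) (g := fun z => f z.1 z.2)).
  by apply: differentiable_pair.
exact: (Cinfty_differentiable (f := fun z => f z.1 z.2) sf).
Qed.

Lemma scale_neq0 (t : R) y : 0 < t -> y != 0 -> t *: y != 0.
Proof. by move=> t0 y0; rewrite scaler_eq0 gt_eqF. Qed.

Lemma hom_dx d k f : smooth f -> fiber_hom d f -> fiber_hom d (dx k f).
Proof.
move=> sf hf t x y t0 Ux y0; rewrite /dx.
rewrite (near_eq_derive (g := fun x' => t ^+ d * f x' y)); last first.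
  by apply: filterS (open_nbhs_nbhs (conj openU Ux)) => x' Ux'; exact: hf.
rewrite [LHS]deriveZ//; apply: diff_derivable.
exact: smooth_differentiable_x.
Qed.

Lemma hom_dy d k f : smooth f -> fiber_hom d.+1 f -> fiber_hom d (dy k f).
Proof.
move=> sf hf t x y t0 Ux y0; rewrite /dy.
have t_neq0 : t != 0 by rewrite gt_eqF.
have dty := smooth_differentiable_y sf Ux (scale_neq0 t0 y0).
have dfy := smooth_differentiable_y sf Ux y0.
set v : V := delta_mx 0 k; pose st (z : V) : V := t *: z.
have dst : is_diff y st st by exact: is_diff_scaler.
have Dst : 'D_v st y = t *: v.
  rewrite (deriveE _ (@ex_diff _ _ _ _ _ _ _ dst)).
  by rewrite (@diff_val _ _ _ _ _ _ _ dst).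
have hE : \forall z \near y, t ^+ d.+1 * f x z = f x (st z).
  apply: filterS (open_nbhs_nbhs (conj open_nonzero y0)) => z z0.
  by rewrite [RHS]hf.
have := derive_chain v (@ex_diff _ _ _ _ _ _ _ dst) dty hE.
rewrite Dst deriveZ; last exact: diff_derivable.
rewrite deriveE // linearZ /= -deriveE // => E.
by apply: (mulfI t_neq0); rewrite mulrA -exprS.
Qed.

Lemma derive_sum_dy f x y (v : V) : differentiable (f x) y ->
  'D_v (f x) y = \sum_i v 0 i * dy i f x y.
Proof.
move=> df; rewrite deriveE // {1}(row_sum_delta v) linear_sum /=.
by apply: eq_bigr => i _; rewrite linearZ /dy deriveE.
Qed.

(** Euler's theorem: differentiate [f x (t *: y) = t ^+ d * f x y] in [t] at
    [t = 1]. *)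
Lemma Euler d f x y : smooth f -> fiber_hom d f -> U x -> y != 0 ->
  \sum_i y 0 i * dy i f x y = d%:R * f x y.
Proof.
move=> sf hf Ux y0.
have df := smooth_differentiable_y sf Ux y0.
rewrite -derive_sum_dy //.
pose l (t : R) : V := t *: y.
have dl : is_diff (1 : R) l (fun t : R => t *: y) by exact: is_diff_scalel.
have l1 : l 1 = y by rewrite /l scale1r.
have Dl : 'D_1 l 1 = y.
  rewrite (deriveE _ (@ex_diff _ _ _ _ _ _ _ dl)) (@diff_val _ _ _ _ _ _ _ dl).
  by rewrite scale1r.
have hE : \forall t \near (1 : R), t ^+ d * f x y = f x (l t).
  apply: filterS (lt_nbhsr (ltr01 : 0 < (1 : R))) => t t0.
  by rewrite [RHS]hf.
have dfl : differentiable (f x) (l 1) by rewrite l1.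
have := derive_chain (x := 1 : R) (1 : R) (@ex_diff _ _ _ _ _ _ _ dl) dfl hE.
rewrite Dl l1 => ->.
have -> : 'D_1 (fun t : R => t ^+ d * f x y) (1 : R) =
    f x y * 'D_1 (fun t : R => t ^+ d) (1 : R).
  by rewrite -(deriveMr (f x y) (@exprn_derivable R d 1 1)).
by rewrite exp_derive expr1n [_ *: _]mulr1 [_ *: _]mulr1 mulrC.
Qed.

End SlitFunctions.
(** * Finsler geometry in a chart *)

Section LocalFinsler.
Context {R : realType} {n : nat}.
Local Notation V := 'rV[R]_n.
Variables (U : set V) (L : V -> V -> R).
Hypothesis openU : open U.
Hypothesis smoothL : smooth U L.
Hypothesis homL : fiber_hom U 1 L.
Hypothesis posdefL : forall x y, U x -> y != 0 -> forall u : V, u != 0 ->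
  0 < \sum_i \sum_j g L i j x y * u 0 i * u 0 j.
Implicit Types (f : V -> V -> R) (x y : V) (i j k l m : 'I_n).

Let openS := open_slit_domain openU.

Lemma smooth_ext f f' : (forall x y, U x -> y != 0 -> f x y = f' x y) ->
  smooth U f -> smooth U f'.
Proof.
move=> ff' sf; apply: (Cinfty_ext openS) sf => -[x y] /= [Ux y0].
exact: ff'.
Qed.

Lemma smooth_mul f f' : smooth U f -> smooth U f' ->
  smooth U (fun x y => f x y * f' x y).
Proof. exact: (Cinfty_mul openS). Qed.

Lemma smooth_sub f f' : smooth U f -> smooth U f' ->
  smooth U (fun x y => f x y - f' x y).
Proof. exact: (Cinfty_sub openS). Qed.

Lemma smooth_add f f' : smooth U f -> smooth U f' ->
  smooth U (fun x y => f x y + f' x y).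
Proof. exact: (Cinfty_add openS). Qed.

Lemma smooth_cst (a : R) : smooth U (fun _ _ => a).
Proof. exact: (Cinfty_cst openS). Qed.

Lemma smooth_sum (F : 'I_n -> V -> V -> R) : (forall i, smooth U (F i)) ->
  smooth U (fun x y => \sum_i F i x y).
Proof. by move=> sF; apply: (Cinfty_sum openS) => i _; exact: sF. Qed.

Lemma smooth_inv f : (forall x y, U x -> y != 0 -> f x y != 0) ->
  smooth U f -> smooth U (fun x y => (f x y)^-1).
Proof.
move=> f0; apply: (Cinfty_inv openS) => -[x y] [Ux y0]; exact: f0.
Qed.

Lemma smooth_Fsq : smooth U (Fsq L).
Proof.
apply: smooth_ext (smooth_mul smoothL smoothL) => x y _ _.
by rewrite /Fsq expr2.
Qed.

Lemma hom_Fsq : fiber_hom U 2 (Fsq L).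
Proof. by move=> t x y t0 Ux y0; rewrite /Fsq homL// expr1 exprMn. Qed.

Lemma hom_dyFsq i : fiber_hom U 1 (dy i (Fsq L)).
Proof. exact: (hom_dy _ smooth_Fsq hom_Fsq). Qed.

Lemma gE i j x y : g L i j x y = 2^-1 * dy i (dy j (Fsq L)) x y.
Proof. by rewrite /g mxE. Qed.

Lemma smooth_g i j : smooth U (g L i j).
Proof.
have sd := smooth_dy i (smooth_dy j smooth_Fsq).
apply: smooth_ext (smooth_mul (smooth_cst 2^-1) sd) => x y _ _.
by rewrite gE.
Qed.

Lemma hom_g i j : fiber_hom U 0 (g L i j).
Proof.
move=> t x y t0 Ux y0; rewrite !gE.
by rewrite (hom_dy _ (smooth_dy _ smooth_Fsq) (hom_dyFsq j))// mulrCA.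
Qed.

Lemma g_sym i j x y : U x -> y != 0 -> g L i j x y = g L j i x y.
Proof. by move=> Ux y0; rewrite !gE (dy_swap openU _ _ smooth_Fsq). Qed.

Lemma gmx_unit x y : U x -> y != 0 -> gmx L x y \in unitmx.
Proof.
move=> Ux y0; rewrite -row_free_unit; apply: inj_row_free => u uG.
apply/eqP/negPn/negP => /(posdefL Ux y0).
suff -> : \sum_i \sum_j g L i j x y * u 0 i * u 0 j = 0 by rewrite ltxx.
rewrite exchange_big big1// => j _; rewrite -mulr_suml.
have := congr1 (fun M : V => M 0 j) uG; rewrite !mxE => E.
rewrite (eq_bigr (fun i => u 0 i * gmx L x y i j)) ?E ?mul0r// => i _.
by rewrite mulrC.
Qed.

Lemma smooth_ginv i j : smooth U (ginv L i j).
Proof.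
apply: (Cinfty_invmx openS (M := fun z => gmx L z.1 z.2)).
  by move=> [x y] [Ux y0]; exact: gmx_unit.
by move=> a b; exact: smooth_g.
Qed.

Lemma hom_ginv i j : fiber_hom U 0 (ginv L i j).
Proof.
move=> t x y t0 Ux y0; rewrite /ginv expr0 mul1r.
have -> // : gmx L x (t *: y) = gmx L x y.
by apply/matrixP => a b; have := hom_g a b t0 Ux y0; rewrite expr0 mul1r.
Qed.

Lemma smooth_spray i : smooth U (spray L i).
Proof.
apply: smooth_mul; first exact: smooth_cst.
apply: smooth_sum => l; apply: smooth_mul; first exact: smooth_ginv.
apply: smooth_sub; last exact: smooth_dx _ smooth_Fsq.
apply: smooth_sum => k; apply: smooth_mul (smooth_coord openU k).
exact: smooth_dx _ (smooth_dy _ smooth_Fsq).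
Qed.

Lemma hom_spray i : fiber_hom U 2 (spray L i).
Proof.
move=> t x y t0 Ux y0; rewrite /spray mulrCA; congr (_ * _).
rewrite mulr_sumr; apply: eq_bigr => l _.
rewrite hom_ginv// expr0 mul1r mulrCA; congr (_ * _).
rewrite (hom_dx openU l smooth_Fsq hom_Fsq)// mulrBr; congr (_ - _).
rewrite mulr_sumr; apply: eq_bigr => k _.
rewrite (hom_dx openU k (smooth_dy l smooth_Fsq) (hom_dyFsq l))// mxE.
by rewrite expr1 expr2; ring.
Qed.

Lemma smooth_nconn m k : smooth U (nconn L m k).
Proof. exact: smooth_dy _ (smooth_spray m). Qed.

Lemma hom_nconn m k : fiber_hom U 1 (nconn L m k).
Proof. exact: (hom_dy _ (smooth_spray m) (hom_spray m)). Qed.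

Lemma smooth_berwald i j k l : smooth U (berwald L i j k l).
Proof. by do 3 apply: smooth_dy; exact: smooth_spray. Qed.

Lemma smooth_mean_berwald j k : smooth U (mean_berwald L j k).
Proof.
apply: smooth_mul; first exact: smooth_cst.
by apply: smooth_sum => m; exact: smooth_berwald.
Qed.

Lemma smooth_douglas i j k l : smooth U (douglas L i j k l).
Proof.
apply: smooth_sub; first exact: smooth_berwald.
apply: smooth_mul; first exact: smooth_cst.
have sE a b (c : R) : smooth U (fun x y => mean_berwald L a b x y * c).
  by apply: smooth_mul (smooth_cst c); exact: smooth_mean_berwald.
apply: smooth_add.
  by apply: smooth_add (sE _ _ _); apply: smooth_add (sE _ _ _).
apply: smooth_mul (smooth_coord openU i).
exact: smooth_dy _ (smooth_mean_berwald _ _).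
Qed.

Lemma smooth_ylow i : smooth U (ylow L i).
Proof.
apply: smooth_sum => k; apply: smooth_mul (smooth_coord openU k).
exact: smooth_g.
Qed.

Section AtPoint.
Variables x y : V.
Hypotheses (Ux : U x) (y0 : y != 0).

(** Euler's theorem twice, for [dy j (Fsq L)] of degree 1 and [Fsq L] of
    degree 2. *)
Lemma sum_y_ylow : \sum_i y 0 i * ylow L i x y = Fsq L x y.
Proof.
transitivity (\sum_j y 0 j * (2^-1 * \sum_i y 0 i * dy i (dy j (Fsq L)) x y)).
  rewrite [RHS](eq_bigr (fun j => \sum_i y 0 i * (g L i j x y * y 0 j))).
    by rewrite exchange_big; apply: eq_bigr => i _; rewrite mulr_sumr.
  move=> j _; rewrite !mulr_sumr; apply: eq_bigr => i _; rewrite gE; ring.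
under eq_bigr do
  rewrite (Euler (smooth_dy _ smooth_Fsq) (hom_dyFsq _) Ux y0) mul1r mulrCA.
by rewrite -mulr_sumr (Euler smooth_Fsq hom_Fsq Ux y0) mulrA mulVf ?mul1r.
Qed.

Lemma Fsq_gt0 : 0 < Fsq L x y.
Proof.
rewrite -sum_y_ylow; have := posdefL Ux y0 y0.
rewrite (eq_bigr (fun i => y 0 i * ylow L i x y))// => i _.
by rewrite mulr_sumr; apply: eq_bigr => j _; ring.
Qed.

Lemma L_neq0 : L x y != 0.
Proof. by rewrite -sqrf_eq0 gt_eqF// Fsq_gt0. Qed.

Lemma sum_hmix_y i : \sum_a hmix L i a x y * y 0 a = 0.
Proof.
rewrite (eq_bigr (fun a => (i == a)%:R * y 0 a
    - L x y ^- 2 * y 0 i * (y 0 a * ylow L a x y))); last first.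
  by move=> a _; rewrite /hmix; ring.
rewrite sumrB -mulr_sumr sum_y_ylow (bigD1 i)//= eqxx mul1r big1 => [|a ai].
  by rewrite /Fsq addr0 mulrAC mulVf ?mul1r ?subrr// sqrf_eq0 L_neq0.
by rewrite eq_sym (negbTE ai) mul0r.
Qed.

Lemma sum_hlow_y j : \sum_m y 0 m * hlow L j m x y = 0.
Proof.
rewrite (eq_bigr (fun m => g L j m x y * y 0 m
    - L x y ^- 2 * ylow L j x y * (y 0 m * ylow L m x y))); last first.
  by move=> m _; rewrite /hlow; ring.
rewrite sumrB -mulr_sumr sum_y_ylow /Fsq mulrAC mulVf ?mul1r ?subrr//.
by rewrite sqrf_eq0 L_neq0.
Qed.

Lemma hlow_sym i j : hlow L i j x y = hlow L j i x y.
Proof. by rewrite /hlow g_sym//; ring. Qed.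

Lemma sum_hmix_hlow j k :
  \sum_m hmix L m j x y * hlow L k m x y = hlow L k j x y.
Proof.
rewrite (eq_bigr (fun m => (m == j)%:R * hlow L k m x y
    - L x y ^- 2 * ylow L j x y * (y 0 m * hlow L k m x y))); last first.
  by move=> m _; rewrite /hmix; ring.
rewrite sumrB -mulr_sumr sum_hlow_y mulr0 subr0.
rewrite (bigD1 j)//= eqxx mul1r big1 ?addr0// => m /negbTE ->.
by rewrite mul0r.
Qed.

Lemma trace_hmix : \sum_m hmix L m m x y = n%:R - 1.
Proof.
rewrite (eq_bigr (fun m => 1 - L x y ^- 2 * (y 0 m * ylow L m x y))).
  rewrite sumrB -mulr_sumr sum_y_ylow /Fsq mulVf ?sqrf_eq0 ?L_neq0//.
  by rewrite sumr_const card_ord.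
by move=> m _; rewrite /hmix eqxx /= -mulrA.
Qed.

(** [g] is homogeneous of degree 0. *)
Lemma sum_cartan_y j k : \sum_m y 0 m * cartan L j k m x y = 0.
Proof.
rewrite (eq_bigr (fun m => 2^-1 * (y 0 m * dy m (g L j k) x y))); last first.
  by move=> m _; rewrite /cartan; ring.
rewrite -mulr_sumr (Euler (smooth_g j k) (hom_g j k) Ux y0).
by rewrite mul0r mulr0.
Qed.

End AtPoint.

Lemma derive_coord i p y :
  'D_(delta_mx 0 p : V) (fun z : V => z 0 i) y = (i == p)%:R.
Proof.
pose f (z : V) : R := z 0 i.
have lf : linear f by move=> a u v; rewrite /f !mxE.
pose fM := GRing.isLinear.Build _ _ _ _ f lf.
pose fL : {linear V -> R} := HB.pack f fM.
have cf : continuous fL by exact: coord_continuous.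
have -> : (fun z : V => z 0 i) = fL by [].
rewrite deriveE; last exact: linear_differentiable.
by rewrite diff_lin// /fL /= /f !mxE eqxx.
Qed.

(** The Berwald connection preserves the tensors with values in the line of
    [y], because it preserves the field [y] itself: the horizontal part
    [- N^i_m] of its derivative cancels [y^b G^i_bm] by Euler's theorem. *)
Lemma hcov_radial (T : 'I_n -> 'I_n -> 'I_n -> 'I_n -> V -> V -> R)
    (D : 'I_n -> 'I_n -> 'I_n -> V -> V -> R) :
  (forall j k l, smooth U (D j k l)) ->
  (forall i j k l x y, U x -> y != 0 -> T i j k l x y = D j k l x y * y 0 i) ->
  forall j k l m x y, U x -> y != 0 ->
  exists X, forall i, hcov L T i j k l m x y = X * y 0 i.
Proof.
move=> sD TE j k l m x y Ux y0.
have dxT i : dx m (T i j k l) x y = dx m (D j k l) x y * y 0 i.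
  rewrite /dx (near_eq_derive (g := fun x' => D j k l x' y * y 0 i)).
    have dD := smooth_differentiable_x (sD j k l) Ux y0.
    by rewrite mulrC -(deriveMr _ (diff_derivable (v := delta_mx 0 m) dD)).
  by apply: filterS (open_nbhs_nbhs (conj openU Ux)) => x' Ux'; exact: TE.
have dyT p i : dy p (T i j k l) x y =
    y 0 i * dy p (D j k l) x y + D j k l x y * (i == p)%:R.
  rewrite /dy (near_eq_derive (g := fun y' => D j k l x y' * y' 0 i)).
    have dD := smooth_differentiable_y (sD j k l) Ux y0.
    have dc := differentiable_coord y 0 i.
    rewrite [LHS](deriveM (diff_derivable (v := delta_mx 0 p) dD)
      (diff_derivable (v := delta_mx 0 p) dc)) addrC.
    by rewrite derive_coord.
  have nz := open_nbhs_nbhs (conj (@open_nonzero _ _) y0).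
  by apply: filterS nz => y' y'0; exact: TE.
exists (delta L m (D j k l) x y
  - \sum_a D a k l x y * bconn L a j m x y
  - \sum_a D j a l x y * bconn L a k m x y
  - \sum_a D j k a x y * bconn L a l m x y) => i.
have TB a b c p q : \sum_e T i (a e) (b e) (c e) x y * bconn L e p q x y =
   (\sum_e D (a e) (b e) (c e) x y * bconn L e p q x y) * y 0 i.
  by rewrite mulr_suml; apply: eq_bigr => e _; rewrite TE//; ring.
have N1 : \sum_a T a j k l x y * bconn L i a m x y =
    D j k l x y * nconn L i m x y.
  rewrite -[nconn L i m x y]mul1r.
  rewrite -(Euler (smooth_nconn i m) (hom_nconn i m) Ux y0) mulr_sumr.
  by apply: eq_bigr => a _; rewrite TE// /bconn /nconn mulrA.
have N2 : \sum_p nconn L p m x y * dy p (T i j k l) x y =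
    (\sum_p nconn L p m x y * dy p (D j k l) x y) * y 0 i
    + D j k l x y * nconn L i m x y.
  under eq_bigr do rewrite dyT [y 0 i * _]mulrC mulrDr.
  rewrite big_split /=; congr (_ + _).
    by rewrite mulr_suml; apply: eq_bigr => p _; rewrite mulrA.
  rewrite (bigD1 i)//= eqxx mulr1 big1 ?addr0 1?mulrC// => p /negbTE.
  by rewrite eq_sym => ->; rewrite !mulr0.
have dT : delta L m (T i j k l) x y =
    delta L m (D j k l) x y * y 0 i - D j k l x y * nconn L i m x y.
  by rewrite [LHS]/delta dxT N2 /delta mulrBl opprD addrA.
rewrite /hcov !mulrBl.
rewrite -[X in _ = X - _ - _ - _](subrK (D j k l x y * nconn L i m x y)).
congr (_ + _ - _ - _ - _).
- by rewrite dT /delta mulrBl.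
- exact: N1.
- exact: (TB id (fun=> k) (fun=> l)).
- exact: (TB (fun=> j) id (fun=> l)).
- exact: (TB (fun=> j) (fun=> k) id).
Qed.


(** * Generalized isotropic Berwald metrics *)

Section IsotropicBerwald.
Variables mu lam : V -> V -> R.
Hypothesis isotropic : forall x y, U x -> y != 0 -> forall i j k l,
  berwald L i j k l x y = mu x y * cartan L j k l x y * ell L i x y
    + lam x y * (hmix L i j x y * hlow L k l x y
       + hmix L i k x y * hlow L j l x y + hmix L i l x y * hlow L j k x y).

(** The trace over [i] and [l] of the hypothesis; the contributions of the
    three products of angular metrics to the factor are 1, 1 and [n - 1]. *)
Lemma mean_berwald_isotropic j k x y : U x -> y != 0 ->
  mean_berwald L j k x y = 2^-1 * n.+1%:R * lam x y * hlow L j k x y.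
Proof.
move=> Ux y0; rewrite /mean_berwald.
rewrite (eq_bigr (fun m => mu x y / L x y * (y 0 m * cartan L j k m x y)
    + lam x y * (hmix L m j x y * hlow L k m x y)
    + lam x y * (hmix L m k x y * hlow L j m x y)
    + lam x y * (hmix L m m x y * hlow L j k x y))); last first.
  by move=> m _; rewrite isotropic// /ell; ring.
rewrite !big_split /= -!mulr_sumr -mulr_suml sum_cartan_y// !sum_hmix_hlow//.
rewrite trace_hmix// (hlow_sym Ux y0 k j) -natr1; ring.
Qed.

(** The factor of [y 0 i] is kept explicit only up to the derivative of the
    mean Berwald curvature: rewriting that in terms of [lam] would require
    [lam] to be differentiable. *)
Lemma douglas_isotropic i j k l x y : U x -> y != 0 ->
  douglas L i j k l x y =
    (mu x y / L x y * cartan L j k l x y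
     - lam x y * L x y ^- 2 * (ylow L j x y * hlow L k l x y
         + ylow L k x y * hlow L j l x y + ylow L l x y * hlow L j k x y)
     - 2 / n.+1%:R * dy l (mean_berwald L j k) x y) * y 0 i.
Proof.
move=> Ux y0; rewrite /douglas !mean_berwald_isotropic// isotropic// /ell /hmix.
have n0 : n.+1%:R != 0 :> R by rewrite pnatr_eq0.
have L0 := L_neq0 Ux y0.
by field; rewrite L0 addrC natr1 n0.
Qed.

Lemma douglas_weyl_isotropic i j k l x y : U x -> y != 0 ->
  \sum_a hmix L i a x y *
    (\sum_m hcov L (douglas L) a j k l m x y * y 0 m) = 0.
Proof.
move=> Ux y0.
(* The radial factor, recovered by contraction with [ylow] so that its
   smoothness is visible. *)
pose D j k l x y := (\sum_i ylow L i x y * douglas L i j k l x y) / Fsq L x y.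
have sD b c d : smooth U (D b c d).
  apply: smooth_mul; last first.
    by apply: smooth_inv smooth_Fsq => x' y' Ux' y'0; rewrite gt_eqF// Fsq_gt0.
  apply: smooth_sum => e; apply: smooth_mul; first exact: smooth_ylow.
  exact: smooth_douglas.
have DE a b c d x' y' : U x' -> y' != 0 ->
    douglas L a b c d x' y' = D b c d x' y' * y' 0 a.
  move=> Ux' y'0; have F0 : Fsq L x' y' != 0 by rewrite gt_eqF// Fsq_gt0.
  rewrite /D douglas_isotropic//; set S := (X in X * _).
  rewrite (eq_bigr (fun e => S * (y' 0 e * ylow L e x' y'))).
    by rewrite -mulr_sumr sum_y_ylow// mulfK.
  by move=> e _; rewrite douglas_isotropic// mulrC mulrA.
have /(_ _)/cid-/all_sig[X XE] m := hcov_radial sD DE j k l m Ux y0.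
rewrite (eq_bigr (fun a => (\sum_m X m * y 0 m) * (hmix L i a x y * y 0 a))).
  by rewrite -mulr_sumr sum_hmix_y// mulr0.
move=> a _; rewrite mulrCA; congr (_ * _); rewrite mulr_suml.
by apply: eq_bigr => m _; rewrite XE mulrAC.
Qed.

End IsotropicBerwald.
End LocalFinsler.
(** * Passage from the manifold to a chart *)

Section Charts.
Context {R : realType} {n : nat} {M : manifold R n}.

Lemma tangent_bundle_eq (v w : tangent_bundle M) :
  tbase v = tbase w -> tcomp v = tcomp w -> v = w.
Proof.
case: v w => [p f pf qf] [q h ph qh] /= E; subst q => E; subst h.
by congr TangentVector; exact: Prop_irrelevance.
Qed.

(** Turns the homogeneity of [F] on tangent vectors into that of its local
    expression. *)
Lemma tlocal_scale (c : mindex M) (t : R) (x y : 'rV[R]_n) :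
  tlocal c x (t *: y) = tscale t (tlocal c x y).
Proof.
apply: tangent_bundle_eq => //; apply/funext => j.
rewrite /= /tscale_comp /= /tlocal_comp.
case: asboolP => [[cx jx]|_]; last by rewrite scaler0.
by rewrite !deriveE ?linearZ//; exact: transition_differentiable.
Qed.

End Charts.

Theorem theorem1p1 (R : realType) (n : nat) (M : manifold R n)
    (F : tangent_bundle M -> R) :
  is_finsler F -> generalized_isotropic_berwald F ->
  generalized_douglas_weyl F.
Proof.
move=> [_ Fsmooth Fhom Fpos] [mu [lambda [_ _ isotropic]]].
move=> c x y cx y0 L i j k l.
apply: (@douglas_weyl_isotropic _ _ (crange (mchart M c)) L _ _ _ _
  (fun x y => mu (tlocal c x y)) (fun x y => lambda (tlocal c x y))) => //.
- exact: open_crange.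
- exact: Fsmooth.
- by move=> t x' y' t0 _ _; rewrite expr1 /L /in_chart tlocal_scale Fhom.
- exact: Fpos.
- by move=> x' y' cx' y'0; exact: isotropic.
Qed.
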